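(* There exists a natural surjection $\pi_0^{\mathrm{Crs}}(-)\twoheadrightarrow\mathcal{E}\mathrm{nds}(-)$ of functors $\mathbf{PGeo}^{\mathrm{Crs}}\to\mathbf{Set}$, i.e. a natural transformation all of whose components $\pi_0^{\mathrm{Crs}}(X)\to\mathcal{E}\mathrm{nds}(X)$ are surjective.
   Context: A metric space is proper if its closed bounded subsets are exactly its compact subsets. A metric space $X$ is geodesic if any $x,x'\in X$ are joined by a geodesic, i.e. an isometric embedding $u_{x,x'}:[0,a_{x,x'}]\to X$ with $a_{x,x'}=d_X(x,x')$, $u_{x,x'}(0)=x$, $u_{x,x'}(a_{x,x'})=x'$. A map $f:X\to Y$ of metric spaces is controlled if for every $R>0$ there is $S>0$ such that $d_X(x,x')<R$ implies $d_Y(f(x),f(x'))<S$; (metrically) proper if preimages of bounded sets are bounded; coarse if both. $\mathbf{PGeo}^{\mathrm{Crs}}$ is the category of proper geodesic metric spaces and coarse maps. Functor $\mathcal{E}\mathrm{nds}$: for proper $X$, two metrically proper continuous maps (rays) $r,r':\mathbb{R}_{\ge0}\to X$ are equivalent if for every bounded $B\subseteq X$ there is $t\ge0$ such that $r([t,\infty))$ and $r'([t,\infty))$ lie in the same path component of $X\setminus B$. $\mathcal{E}\mathrm{nds}(X)$ is the set of classes $\mathrm{end}(r)$ of metrically proper continuous rays $r$. For any map $r:\mathbb{R}_{\ge0}\to X$ to a geodesic space, $r^*$ is the continuous map $r^*(h)=u_{r(\lfloor h\rfloor),r(\lceil h\rceil)}\big(a_{r(\lfloor h\rfloor),r(\lceil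 h\rceil)}(h-\lfloor h\rfloor)\big)$ for a choice of geodesics. The functor $\mathcal{E}\mathrm{nds}(-)$ sends $X$ to $\mathcal{E}\mathrm{nds}(X)$ and a coarse map $f:X\to Y$ to the function $f_{\mathcal{E}}:\mathcal{E}\mathrm{nds}(X)\to\mathcal{E}\mathrm{nds}(Y)$, $\mathrm{end}(r)\mapsto\mathrm{end}((f\circ r)^* )$. Functor $\pi_0^{\mathrm{Crs}}$: for a coarse map $q:X\to\mathbb{R}_{\ge0}$, let $I_qX=\{(x,t)\in X\times\mathbb{R}_{\ge0}:t\le q(x)\}$ with the restriction of the max product metric. Coarse maps $f,g:X\to Y$ are coarse homotopic if there are coarse maps $q:X\to\mathbb{R}_{\ge0}$ and $H:I_qX\to Y$ with $H(x,0)=f(x)$, $H(x,q(x))=g(x)$ for all $x$; this is an equivalence relation. $\pi_0^{\mathrm{Crs}}(X)$ is the set of coarse homotopy classes $[\alpha]_0^{\mathrm{Crs}}$ of coarse maps $\alpha:\mathbb{R}_{\ge0}\to X$, and a coarse map $f:X\to Y$ is sent to $f_*:[\alpha]_0^{\mathrm{Crs}}\mapsto[f\circ\alpha]_0^{\mathrm{Crs}}$.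
   Formalization: The formula end(r) ↦ end((f∘r)^* ) is evaluated on a controlled representative r of each end, since for a merely continuous proper ray (f∘r)^* need not be metrically proper; it is proved to agree with the stated formula whenever (f∘r)^* is metrically proper. *)

(* Defs.v *)
From HB Require Import structures.
From mathcomp Require Import all_boot all_order all_algebra generic_quotient.
From mathcomp Require Import all_classical all_reals topology normedtype.
From mathcomp Require Import lra.

Set Implicit Arguments.
Unset Strict Implicit.
Unset Printing Implicit Defensive.

Import Order.TTheory GRing.Theory Num.Theory.
Import numFieldNormedType.Exports.

Local Open Scope classical_set_scope.
Local Open Scope ring_scope.
Local Open Scope quotient_scope.

Section SubMetric.
Variables (R : realType) (X : metricType R) (P : pred X).

(* The subset P of X with the restricted metric. *)
Definition sub_metric := {x : X | P x}.

HB.instance Definition _ := Choice.on sub_metric.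

Let dist (x y : sub_metric) : R := mdist (val x) (val y).

Let dist_xx x : dist x x = 0. Proof. exact: mdistxx. Qed.
Let dist_pos x y : dist x y = 0 -> x = y.
Proof. by move=> /mdist_positivity /val_inj. Qed.
Let dist_sym x y : dist x y = dist y x. Proof. exact: metric_sym. Qed.
Let dist_tri y x z : dist x z <= dist x y + dist y z.
Proof. exact: metric_triangle. Qed.

HB.instance Definition _ :=
  isMetric.Build R sub_metric dist_xx dist_pos dist_sym dist_tri.

Lemma sub_mdistE (x y : sub_metric) : mdist x y = mdist (val x) (val y).
Proof. by []. Qed.

End SubMetric.

(* The max metric, compatible with the product uniformity of the library. *)
Section ProdMetric.
Variables (R : realType) (X Y : metricType R).

Let dist (p q : X * Y) : R := Num.max (mdist p.1 q.1) (mdist p.2 q.2).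

Let dist_ge0 p q : 0 <= dist p q.
Proof. by rewrite le_max mdist_ge0. Qed.

Let dist_pos p q : dist p q = 0 -> p = q.
Proof.
case: p q => [a b] [c d] => pq0.
have : dist (a, b) (c, d) <= 0 by rewrite pq0.
rewrite ge_max /= => /andP[ac bd]; congr pair; apply: mdist_positivity;
  by apply/eqP; rewrite eq_le mdist_ge0 andbT.
Qed.

Let ballE p d : ball p d = [set q | dist p q < d].
Proof.
apply/seteqP; split=> q; rewrite /ball /= /prod_ball !ballEmdist /= gt_max.
  by case=> -> ->.
by move=> /andP[].
Qed.

HB.instance Definition _ :=
  PseudoMetric_isMetric.Build R (X * Y)%type dist_ge0 dist_pos ballE.

Lemma prod_mdistE (p q : X * Y) :
  mdist p q = Num.max (mdist p.1 q.1) (mdist p.2 q.2).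
Proof. by []. Qed.

End ProdMetric.

Section Coarse.
Variable R : realType.

Definition mbounded (X : metricType R) (A : set X) :=
  exists M : R, forall x y, A x -> A y -> mdist x y <= M.

Definition proper_space (X : metricType R) :=
  forall A : set X, (closed A /\ mbounded A) <-> compact A.

(* A map defined on [0, d(x, x')] is encoded as a function on R of which only
   the values on this interval matter. *)
Definition is_geodesic (X : metricType R) (x x' : X) (u : R -> X) :=
  [/\ u 0 = x, u (mdist x x') = x' &
      forall s t, s \in `[0, mdist x x'] -> t \in `[0, mdist x x'] ->
        mdist (u s) (u t) = `|s - t| ].

Definition geodesic_space (X : metricType R) :=
  forall x x' : X, exists u, is_geodesic x x' u.

Definition controlled (X Y : metricType R) (f : X -> Y) :=
  forall r : R, 0 < r -> exists2 s : R, 0 < s &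
    forall x x', mdist x x' < r -> mdist (f x) (f x') < s.

Definition metrically_proper (X Y : metricType R) (f : X -> Y) :=
  forall B : set Y, mbounded B -> mbounded (f @^-1` B).

Record coarse_map (X Y : metricType R) := CoarseMap {
  coarse_fun :> X -> Y;
  coarse_controlled : controlled coarse_fun;
  coarse_proper : metrically_proper coarse_fun }.

HB.instance Definition _ X Y := gen_eqMixin (coarse_map X Y).
HB.instance Definition _ X Y := gen_choiceMixin (coarse_map X Y).

Record pgeo := PGeo {
  pgeo_space :> metricType R;
  pgeo_proper : proper_space pgeo_space;
  pgeo_geodesic : geodesic_space pgeo_space }.

End Coarse.

Arguments coarse_map {R} X Y.

Definition Rge0 (R : realType) := @sub_metric R R^o (fun x => 0 <= x).
HB.instance Definition _ (R : realType) := Metric.on (Rge0 R).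

Section Ends.
Variables (R : realType) (X : metricType R).

Record ray := Ray {
  ray_fun :> Rge0 R -> X;
  ray_continuous : continuous ray_fun;
  ray_proper : metrically_proper ray_fun }.

HB.instance Definition _ := gen_eqMixin ray.
HB.instance Definition _ := gen_choiceMixin ray.

(* Path component of x in C; it is empty when x is not in C. *)
Definition path_component (C : set X) (x : X) : set X :=
  [set y | exists c : R -> X,
    [/\ {within `[0, 1], continuous c}, c 0 = x, c 1 = y &
        forall t, t \in `[0, 1] -> C (c t)] ].

Definition ends_equiv (r r' : ray) :=
  forall B : set X, mbounded B -> exists t : Rge0 R, exists2 x, ~ B x &
    forall s : Rge0 R, val t <= val s ->
      path_component (~` B) x (r s) /\ path_component (~` B) x (r' s).

End Ends.

Section MetricFacts.
Variable R : realType.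
Implicit Types X Y : metricType R.

Lemma nbhs_mdist X (x : X) (P : set X) :
  nbhs x P <-> exists2 d : R, 0 < d & forall y, mdist x y < d -> P y.
Proof.
split=> [/nbhs_ballP[d d0 dP]|[d d0 dP]].
  by exists d => // y xy; apply: dP; rewrite ballEmdist.
by apply/nbhs_ballP; exists d => // y; rewrite ballEmdist; exact: dP.
Qed.

Lemma continuous_mdist X Y (f : X -> Y) :
  continuous f <-> forall x (e : R), 0 < e -> exists2 d : R, 0 < d &
    forall y, mdist x y < d -> mdist (f x) (f y) < e.
Proof.
split=> [fc x e e0|fc x P /nbhs_mdist[e e0 eP]].
  have : nbhs (f x) [set y | mdist (f x) y < e] by apply/nbhs_mdist; exists e.
  by move=> /(fc x)/nbhs_mdist.
have [d d0 dP] := fc x e e0.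
by apply/nbhs_mdist; exists d => // y /dP; exact: eP.
Qed.

Definition cont01 X (c : R -> X) :=
  forall s, 0 <= s <= 1 -> forall e : R, 0 < e -> exists2 d : R, 0 < d &
    forall t, 0 <= t <= 1 -> `|s - t| < d -> mdist (c s) (c t) < e.

Lemma within_cont01 X (c : R -> X) :
  {within `[0, 1], continuous c} <-> cont01 c.
Proof.
rewrite subspace_continuousP; split=> cc s.
  move=> s01 e e0.
  have s01' : `[0, 1]%classic s by rewrite /= in_itv.
  have : nbhs (c s) [set y | mdist (c s) y < e] by apply/nbhs_mdist; exists e.
  move=> /(cc s s01')/nbhs_ballP[d /= d0 dP]; exists d => // t t01 st.
  by apply: (dP t); rewrite ?in_itv.
rewrite /= in_itv /= => s01 P /nbhs_mdist[e e0 eP].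
have [d d0 dP] := cc s s01 e e0.
by apply/nbhs_ballP; exists d => // t st; rewrite /= in_itv /= => t01; exact/eP/dP.
Qed.

Let clamp (u : R) : R := Num.max 0 (Num.min u 1).

Let clamp01 u : 0 <= clamp u <= 1.
Proof.
by rewrite /clamp le_max ge_max ge_min !lexx ler01 orbT.
Qed.

Let clamp_lip u v : `|clamp u - clamp v| <= `|u - v|.
Proof.
have ? : 0 <= 1 :> R by exact: ler01.
have := ler_norm (u - v); have := ler_norm (v - u); rewrite (distrC v) => ? ?.
rewrite /clamp; case: (leP u 1) => ?; case: (leP v 1) => ?;
  rewrite ?(@max_r _ _ 0 1) //; case: (leP 0 u) => ?; case: (leP 0 v) => ?;
  rewrite ler_norml; apply/andP; split; lra.
Qed.

Lemma path_component_total X (C : set X) x y :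
  path_component C x y -> exists c : R -> X,
  [/\ forall s (e : R), 0 < e -> exists2 d : R, 0 < d &
        forall t, `|s - t| < d -> mdist (c s) (c t) < e,
      forall u, u <= 0 -> c u = x,
      forall u, 1 <= u -> c u = y & forall u, C (c u)].
Proof.
move=> [c [/within_cont01 cc c0 c1 cC]]; exists (fun u => c (clamp u)); split.
- move=> s e e0; have [d d0 dP] := cc _ (clamp01 s) e e0; exists d => // t st.
  by apply: dP; rewrite ?clamp01 ?(le_lt_trans (clamp_lip _ _)).
- by move=> u u0; rewrite /clamp min_l ?max_l //; lra.
- by move=> u u1; rewrite /clamp min_r ?max_r //; lra.
- by move=> u; apply: cC; rewrite in_itv; exact: clamp01.
Qed.

Lemma path_component_in X (C : set X) x y :
  path_component C x y -> C x /\ C y.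
Proof.
move=> [c [_ <- <- cC]].
by split; apply: cC; rewrite in_itv /= ?lexx ?ler01.
Qed.

Lemma path_component_refl X (C : set X) x : C x -> path_component C x x.
Proof.
move=> Cx; exists (fun=> x); split=> //; apply/within_cont01 => s _ e e0.
by exists 1 => // t _ _; rewrite mdistxx.
Qed.

Lemma path_component_sym X (C : set X) x y :
  path_component C x y -> path_component C y x.
Proof.
move=> [c [/within_cont01 cc c0 c1 cC]]; exists (fun u => c (1 - u)).
split; rewrite ?subr0 ?subrr //.
  apply/within_cont01 => s s01 e e0.
  have [|d d0 dP] := cc (1 - s) _ e e0; first by lra.
  exists d => // t t01 st; apply: dP; first by lra.
  by rewrite (_ : 1 - s - (1 - t) = t - s) 1?distrC //; lra.
move=> t; rewrite in_itv /= => t01; apply: cC; rewrite in_itv /=; lra.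
Qed.

Lemma path_component_trans X (C : set X) x y z :
  path_component C x y -> path_component C y z -> path_component C x z.
Proof.
move=> /path_component_total[c [cc c0 c1 cC]].
move=> /path_component_total[c' [cc' c0' c1' cC']].
exists (fun u => if u <= 2^-1 then c (2 * u) else c' (2 * u - 1)); split.
- apply/within_cont01 => s s01 e e0.
  have e20 : 0 < e / 2 by lra.
  have [d d0 dP] := cc (2 * s) _ e20.
  have [d' d'0 dP'] := cc' (2 * s - 1) _ e20.
  exists (Num.min (d / 2) (d' / 2)); first by rewrite lt_min; apply/andP; lra.
  move=> t t01; rewrite lt_min => /andP[std std'].
  have {}dP : mdist (c (2 * s)) (c (2 * t)) < e / 2.
    by apply: dP; rewrite -mulrBr normrM ger0_norm //; lra.
  have {}dP' : mdist (c' (2 * s - 1)) (c' (2 * t - 1)) < e / 2.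
    apply: dP'; rewrite (_ : _ - _ = 2 * (s - t)); last by lra.
    by rewrite normrM ger0_norm //; lra.
  case: (leP s) => s2; case: (leP t) => t2; try by lra.
    rewrite (c1 (2 * t)) in dP; last by lra.
    rewrite (c0' (2 * s - 1)) in dP'; last by lra.
    by have := metric_triangle (c (2 * s)) y (c' (2 * t - 1)); lra.
  rewrite (c1 (2 * s)) in dP; last by lra.
  rewrite (c0' (2 * t - 1)) in dP'; last by lra.
  have := metric_triangle (c' (2 * s - 1)) y (c (2 * t)); lra.
- by rewrite ifT ?c0 //; lra.
- by rewrite ifF ?c1' //; lra.
- by move=> t _; case: ifP => _; [exact: cC|exact: cC'].
Qed.

Lemma unit_interval_ind (P : R -> Prop) : P 0 ->
  (forall s, 0 <= s <= 1 -> exists2 d : R, 0 < d & forall s1 s2,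
     0 <= s1 <= 1 -> 0 <= s2 <= 1 -> `|s1 - s| < d -> `|s2 - s| < d ->
     P s1 -> P s2) ->
  P 1.
Proof.
move=> P0 Ploc; pose A := [set s : R | 0 <= s <= 1 /\ P s].
have A0 : A 0 by split; rewrite ?lexx ?ler01.
have supA : has_sup A by split; [exists 0|exists 1 => s [/andP[]]].
have le_sup s : A s -> s <= sup A by move=> As; apply: ub_le_sup => //; case: supA.
have s01 : 0 <= sup A <= 1.
  by rewrite le_sup //=; apply: ge_sup; [exists 0|move=> s [/andP[]]].
have [d d0 dP] := Ploc _ s01.
have [a [a01 Pa] sa] := sup_adherent d0 supA.
have as_ : a <= sup A by apply: le_sup.
have [s1|s1] := leP 1 (sup A + d / 2).
  apply: (dP a); rewrite ?lexx ?ler01 //.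
    by rewrite ler0_norm; lra.
  by rewrite ger0_norm; lra.
suff : sup A + d / 2 <= sup A by lra.
apply: le_sup; split; first by lra.
apply: (dP a) => //; first by lra.
  by rewrite ler0_norm; lra.
by rewrite ger0_norm; lra.
Qed.

Definition nbhd X (B : set X) (e : R) : set X :=
  [set y | exists2 b, B b & mdist y b <= e].

Lemma mboundedP X (A : set X) (x0 : X) :
  mbounded A <-> exists M : R, forall y, A y -> mdist x0 y <= M.
Proof.
split=> [[M AM]|[M AM]]; last first.
  exists (M + M) => x y /AM x0x /AM x0y.
  by have := metric_triangle x x0 y; rewrite (metric_sym x x0); lra.
have [[a Aa]|A0] := pselect (A !=set0); last first.
  by exists 0 => y Ay; case: A0; exists y.
exists (mdist x0 a + M) => y Ay.
by have := metric_triangle x0 a y; have := AM _ _ Aa Ay; lra.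
Qed.

Lemma mbounded_nbhd X (B : set X) e : mbounded B -> mbounded (nbhd B e).
Proof.
move=> [M BM]; exists (e + M + e) => x y [b Bb xb] [b' Bb' yb'].
have := BM _ _ Bb Bb'; have := metric_triangle x b y.
by have := metric_triangle b b' y; rewrite (metric_sym b' y); lra.
Qed.

Lemma mboundedS X (A B : set X) : A `<=` B -> mbounded B -> mbounded A.
Proof. by move=> AB [M BM]; exists M => x y /AB Bx /AB By; exact: BM. Qed.

Lemma geodesic_dist X (x x' : X) u s : is_geodesic x x' u ->
  s \in `[0, mdist x x'] -> mdist x (u s) = s.
Proof.
move=> [u0 _ uP] s0; rewrite -{1}u0 uP //.
  by move: s0; rewrite in_itv /= => /andP[? _]; rewrite sub0r normrN ger0_norm.
by rewrite in_itv /= lexx mdist_ge0.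
Qed.

Lemma joined_close X (B : set X) (e : R) x y : geodesic_space X ->
  ~ nbhd B e x -> mdist x y <= e -> path_component (~` B) x y.
Proof.
move=> gX xB xy; have [u ug] := gX x y.
have d0 := mdist_ge0 x y.
have itv t : 0 <= t <= 1 -> t * mdist x y \in `[0, mdist x y].
  by rewrite in_itv /= => /andP[t0 t1]; rewrite mulr_ge0 //= ler_piMl.
case: (ug) => u0 u1 uP; exists (fun t => u (t * mdist x y)).
split; rewrite ?mul0r ?mul1r //.
  apply/within_cont01 => s s01 e' e'0; exists (e' / (1 + mdist x y)).
    by rewrite divr_gt0 //; lra.
  move=> t t01; rewrite ltr_pdivlMr; last by lra.
  rewrite uP ?itv // -mulrBl normrM (ger0_norm d0) mulrDr mulr1.
  by have := normr_ge0 (s - t); lra.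
move=> t; rewrite in_itv => /itv t01 /= But; apply: xB.
exists (u (t * mdist x y)) => //; rewrite (geodesic_dist ug) //.
by move: t01; rewrite in_itv /=; lra.
Qed.

End MetricFacts.

Section CoarseFacts.
Variable R : realType.
Implicit Types X Y Z : metricType R.

Lemma coarse_map_eq X Y (f g : coarse_map X Y) : f =1 g -> f = g.
Proof.
case: f g => [f fc fp] [g gc gp] /= /funext fg; case: _ / fg in gc gp *.
by congr CoarseMap; exact: Prop_irrelevance.
Qed.

Lemma controlled_comp X Y Z (g : Y -> Z) (f : X -> Y) :
  controlled g -> controlled f -> controlled (g \o f).
Proof.
move=> gc fc r /fc[s /gc[t t0 gt] fs]; exists t => // x x' /fs; exact: gt.
Qed.

Lemma proper_comp X Y Z (g : Y -> Z) (f : X -> Y) :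
  metrically_proper g -> metrically_proper f -> metrically_proper (g \o f).
Proof. by move=> gp fp B /gp/fp. Qed.

Lemma controlled_id X : controlled (@id X).
Proof. by move=> r r0; exists r. Qed.

Lemma proper_id X : metrically_proper (@id X).
Proof. by []. Qed.

Definition coarse_id X : coarse_map X X :=
  CoarseMap (@controlled_id X) (@proper_id X).

Definition coarse_comp X Y Z (g : coarse_map Y Z) (f : coarse_map X Y) :
    coarse_map X Z :=
  CoarseMap (controlled_comp (coarse_controlled g) (coarse_controlled f))
    (proper_comp (@coarse_proper _ _ _ g) (@coarse_proper _ _ _ f)).

Lemma joined_image X Y (f : X -> Y) (B : set Y) (s : R) x y :
  geodesic_space Y ->
  (forall x x', mdist x x' < 1 -> mdist (f x) (f x') < s) ->
  path_component (~` (f @^-1` nbhd B s)) x y ->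
  path_component (~` B) (f x) (f y).
Proof.
move=> gY fs [c [/within_cont01 cc c0 c1 cC]].
have s0 : 0 < s.
  by have := fs x x; rewrite !mdistxx; apply; exact: ltr01.
rewrite -c1; pose P t := path_component (~` B) (f x) (f (c t)).
apply: (@unit_interval_ind _ P) => [|t t01].
  rewrite /P c0; apply: path_component_refl => Bfx.
  have := cC 0; rewrite in_itv /= lexx ler01 c0 => /(_ isT); apply.
  by exists (f x); rewrite ?mdistxx // ltW.
have [|d d0 dP] := cc t t01 (2^-1); first by rewrite invr_gt0.
exists d => // s1 s2 s101 s201 s1d s2d Ps1.
apply: path_component_trans Ps1 _; apply: (joined_close (e := s)) => //.
  exact/cC.
apply/ltW/fs; have := metric_triangle (c s1) (c t) (c s2).
have := dP s1 s101; rewrite distrC => /(_ s1d).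
have := dP s2 s201; rewrite distrC => /(_ s2d).
by rewrite (metric_sym (c s1) (c t)); lra.
Qed.

End CoarseFacts.

Section Star.
Variables (R : realType) (X : metricType R).

Lemma floor_Rge0_subproof (h : Rge0 R) : 0 <= (Num.floor (val h))%:~R :> R.
Proof. by rewrite ler0z floor_ge0; exact: valP. Qed.

Lemma ceil_Rge0_subproof (h : Rge0 R) : 0 <= (Num.ceil (val h))%:~R :> R.
Proof.
by rewrite ler0z ceil_ge0; apply: lt_le_trans (valP h); rewrite oppr_lt0 ltr01.
Qed.

Definition floor_Rge0 (h : Rge0 R) : Rge0 R := Sub _ (floor_Rge0_subproof h).
Definition ceil_Rge0 (h : Rge0 R) : Rge0 R := Sub _ (ceil_Rge0_subproof h).

Definition geodesic_choice (u : X -> X -> R -> X) :=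
  forall x x', is_geodesic x x' (u x x').

(* The map r^*, geodesic interpolation of the values of r at the integers. *)
Definition star (u : X -> X -> R -> X) (r : Rge0 R -> X) (h : Rge0 R) : X :=
  let x := r (floor_Rge0 h) in let x' := r (ceil_Rge0 h) in
  u x x' (mdist x x' * (val h - val (floor_Rge0 h))).

End Star.

Section RaysOfRge0.
Variable R : realType.
Implicit Type X : metricType R.

Lemma Rge0_mdistE (h h' : Rge0 R) : mdist h h' = `|val h' - val h|.
Proof. by []. Qed.

Definition nat_Rge0 (n : nat) : Rge0 R := Sub (n%:R : R^o) (ler0n R n).

Lemma floor_Rge0E (h : Rge0 R) n : n%:R <= val h < n.+1%:R ->
  floor_Rge0 h = nat_Rge0 n.
Proof.
move=> hn; apply: val_inj; rewrite /= (@floor_def _ _ n%:Z) //.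
by rewrite intrD natr1.
Qed.

Lemma ceil_Rge0E (h : Rge0 R) n : n%:R < val h <= n.+1%:R ->
  ceil_Rge0 h = nat_Rge0 n.+1.
Proof.
move=> hn; apply: val_inj; rewrite /= (@ceil_def _ _ n.+1%:Z) //.
by rewrite -addn1 PoszD addrK -PoszD addn1.
Qed.

Lemma ceil_nat_Rge0 n : ceil_Rge0 (nat_Rge0 n) = nat_Rge0 n.
Proof.
apply: val_inj; rewrite /= (@ceil_def _ _ n%:Z) //.
by rewrite lexx andbT intrD ltrBlDr ltrDl ltr01.
Qed.

Lemma floor_nat_Rge0 n : floor_Rge0 (nat_Rge0 n) = nat_Rge0 n.
Proof. by apply: floor_Rge0E; rewrite /= lexx ltr_nat ltnSn. Qed.

Lemma Rge0_itv (h : Rge0 R) : exists n, n%:R <= val h < n.+1%:R.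
Proof. by exists (Num.trunc (val h)); exact/truncn_itv/valP. Qed.

Lemma natr_large (M : R) : exists n, M <= n%:R.
Proof.
by exists (Num.trunc `|M|).+1; rewrite (le_trans (ler_norm M)) // ltW // truncnS_gt.
Qed.

Lemma Rge0_boundedP (A : set (Rge0 R)) :
  mbounded A <-> exists M : R, forall h, A h -> val h <= M.
Proof.
split=> [/(mboundedP _ (nat_Rge0 0))[M AM]|[M AM]].
  exists M => h /AM; rewrite Rge0_mdistE /= subr0; apply: le_trans.
  exact: ler_norm.
apply/(mboundedP _ (nat_Rge0 0)); exists M => h /AM.
by rewrite Rge0_mdistE /= subr0 ger0_norm //; exact: valP.
Qed.

(* Equal to 0 on negative reals. *)
Definition clamp_Rge0 (x : R) : Rge0 R :=
  insubd (nat_Rge0 0) (x : R^o).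

Lemma clamp_Rge0K x : 0 <= x -> val (clamp_Rge0 x) = x.
Proof. by move=> x0; rewrite /clamp_Rge0 insubdK. Qed.

Lemma val_clamp_Rge0 (h : Rge0 R) : clamp_Rge0 (val h) = h.
Proof. exact: valKd. Qed.

Lemma star_on X u (r : Rge0 R -> X) n (h : Rge0 R) : geodesic_choice u ->
  n%:R <= val h <= n.+1%:R ->
  star u r h = u (r (nat_Rge0 n)) (r (nat_Rge0 n.+1))
    (mdist (r (nat_Rge0 n)) (r (nat_Rge0 n.+1)) * (val h - n%:R)).
Proof.
move=> ug; have star_nat m : star u r (nat_Rge0 m) = r (nat_Rge0 m).
  rewrite /star floor_nat_Rge0 ceil_nat_Rge0 mdistxx mul0r.
  by case: (ug (r (nat_Rge0 m)) (r (nat_Rge0 m))).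
set x := r _; set x' := r (nat_Rge0 _).
have [u0 u1 _] := ug x x'.
rewrite le_eqVlt => /andP[/orP[/eqP hn|nh]].
  have -> : h = nat_Rge0 n by apply: val_inj; rewrite /= hn.
  by rewrite star_nat /= subrr mulr0 u0.
rewrite le_eqVlt => /orP[/eqP hn|hn].
  have -> : h = nat_Rge0 n.+1 by apply: val_inj; rewrite /= hn.
  by rewrite star_nat /= -natrB // subSnn mulr1 u1.
rewrite /star (@floor_Rge0E h n) ?(@ceil_Rge0E h n) //.
  by rewrite nh ltW.
by rewrite hn ltW.
Qed.

Lemma star_nat X u (r : Rge0 R -> X) n : geodesic_choice u ->
  star u r (nat_Rge0 n) = r (nat_Rge0 n).
Proof.
move=> ug; rewrite (@star_on _ _ _ n) //=; last by rewrite lexx ler_nat /=.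
by rewrite subrr mulr0; case: (ug (r (nat_Rge0 n)) (r (nat_Rge0 n.+1))).
Qed.

Lemma star_step X u (r : Rge0 R -> X) n (h h' : Rge0 R) : geodesic_choice u ->
  n%:R <= val h -> val h <= val h' -> val h' <= n.+1%:R ->
  mdist (star u r h) (star u r h') =
    mdist (r (nat_Rge0 n)) (r (nat_Rge0 n.+1)) * (val h' - val h).
Proof.
move=> ug nh hh' hn; rewrite !(@star_on _ u r n) ?nh ?hn ?(le_trans hh') //;
  last by rewrite (le_trans nh).
set x := r _; set x' := r (nat_Rge0 _).
have d0 := mdist_ge0 x x'.
have itv (k : Rge0 R) : n%:R <= val k -> val k <= n.+1%:R ->
    mdist x x' * (val k - n%:R) \in `[0, mdist x x'].
  rewrite in_itv /= -[n.+1]addn1 natrD => nk kn.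
  by rewrite mulr_ge0 ?subr_ge0 //= ler_piMr //; lra.
have [_ _ ->] := ug x x'; rewrite ?itv ?(le_trans hh') ?(le_trans nh) //.
by rewrite -mulrBr normrM ger0_norm // opprB addrA subrK distrC ger0_norm ?subr_ge0.
Qed.

Lemma star_lip X u (r : Rge0 R -> X) (N : nat) (K : R) : geodesic_choice u ->
  (forall n, (n < N)%N ->
    mdist (r (nat_Rge0 n)) (r (nat_Rge0 n.+1)) <= K) ->
  forall h h' : Rge0 R, val h <= val h' -> val h' <= N%:R ->
  mdist (star u r h) (star u r h') <= K * (val h' - val h).
Proof.
move=> ug; elim: N => [_ h h' hh' h'0|N IH NK h h' hh' h'N].
  have h0 := valP h.
  have -> : h = h' by apply: val_inj; move: h0 hh' h'0 => /=; lra.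
  by rewrite mdistxx subrr mulr0.
have NK' n : (n < N)%N -> mdist (r (nat_Rge0 n)) (r (nat_Rge0 n.+1)) <= K.
  by move=> nN; apply: NK; rewrite ltnS ltnW.
have [h'N'|Nh'] := leP (val h') N%:R; first exact: IH.
have step k : N%:R <= val k -> val k <= val h' ->
    mdist (star u r k) (star u r h') <= K * (val h' - val k).
  move=> Nk kh'; rewrite (@star_step _ _ _ N) // ler_wpM2r ?subr_ge0 //.
  exact: NK.
have [Nh|hN] := leP N%:R (val h); first exact: step.
apply: le_trans (metric_triangle _ (star u r (nat_Rge0 N)) _) _.
have := IH NK' h (nat_Rge0 N) (ltW hN) (lexx _).
have := step (nat_Rge0 N) (lexx _) (ltW Nh').
by rewrite /=; lra.
Qed.

Lemma star_continuous X u (r : Rge0 R -> X) :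
  geodesic_choice u -> continuous (star u r).
Proof.
move=> ug; apply/continuous_mdist => h e e0.
have [n /andP[_ hn]] := Rge0_itv h.
pose a i := mdist (r (nat_Rge0 i)) (r (nat_Rge0 i.+1)).
pose K := \sum_(i < n.+2) a i.
have a0 i : 0 <= a i by exact: mdist_ge0.
have K0 : 0 <= K by exact: sumr_ge0.
have aK i : (i < n.+2)%N -> a i <= K.
  move=> i_n; rewrite /K (bigD1 (Ordinal i_n)) //= lerDl.
  exact: sumr_ge0.
exists (Num.min 1 (e / (K + 1))).
  by rewrite lt_min ltr01 divr_gt0 //; lra.
move=> h'; rewrite lt_min ltr_pdivlMr; last by lra.
rewrite Rge0_mdistE mulrDr mulr1 => /andP[hh'1 hh'e].
have hN : val h <= n.+2%:R.
  by apply: le_trans (ltW hn) _; rewrite ler_nat.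
have h'N : val h' <= n.+2%:R.
  have := ler_norm (val h' - val h); rewrite -[n.+2]addn1 natrD; lra.
have := normr_ge0 (val h' - val h).
have [hh'|h'h] := leP (val h) (val h').
  have := star_lip ug aK hh' h'N.
  rewrite [`|_|]ger0_norm in hh'e *; last by lra.
  by rewrite mulrC; lra.
have := star_lip ug aK (ltW h'h) hN; rewrite metric_sym.
rewrite [`|_|]ler0_norm in hh'e *; last by lra.
by rewrite mulrC; lra.
Qed.

Lemma star_controlled X u (r : Rge0 R -> X) (S : R) : geodesic_choice u ->
  (forall n, mdist (r (nat_Rge0 n)) (r (nat_Rge0 n.+1)) <= S) ->
  controlled (star u r).
Proof.
move=> ug rS.
have S0 : 0 <= S by exact: le_trans (mdist_ge0 _ _) (rS 0%N).
have lip h h' : val h <= val h' ->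
    mdist (star u r h) (star u r h') <= S * (val h' - val h).
  have [N h'N] := natr_large (val h').
  by move=> hh'; apply: (@star_lip _ _ _ N).
move=> e e0; exists (S * e + 1); first by rewrite ltr_wpDl ?mulr_ge0 // ltW.
move=> h h'; rewrite Rge0_mdistE.
wlog hh' : h h' / val h <= val h' => [wl|].
  have [/wl//|h'h] := leP (val h) (val h').
  by rewrite distrC metric_sym; apply: wl; exact: ltW.
rewrite ger0_norm ?subr_ge0 // => hh'e; apply: le_lt_trans (lip _ _ hh') _.
by apply: (@le_lt_trans _ _ (S * e)); rewrite ?ltrDl // ler_wpM2l // ltW.
Qed.

Lemma star_proper X u (r : Rge0 R -> X) (S : R) : geodesic_choice u ->
  (forall n, mdist (r (nat_Rge0 n)) (r (nat_Rge0 n.+1)) <= S) ->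
  (forall B, mbounded B -> exists N, forall n, (N <= n)%N ->
    ~ B (r (nat_Rge0 n))) ->
  metrically_proper (star u r).
Proof.
move=> ug rS rp B /(mbounded_nbhd S)/rp[N NB].
apply/Rge0_boundedP; exists N%:R => h Bh.
have [n nh] := Rge0_itv h; have /andP[nh1 nh2] := nh.
rewrite leNgt; apply/negP => Nh; apply: (NB n).
  by rewrite -ltnS -(ltr_nat R) (lt_trans Nh).
exists (star u r h) => //; rewrite -(star_nat r n ug).
rewrite (@star_step _ _ _ n) ?(ltW nh2) //=.
have S0 := mdist_ge0 (r (nat_Rge0 n)) (r (nat_Rge0 n.+1)).
apply: le_trans (rS n); rewrite ler_piMr // lerBlDr.
by apply: le_trans (ltW nh2) _; rewrite -add1n natrD.
Qed.

Lemma controlled_nat X (r : Rge0 R -> X) : controlled r -> exists S : R,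
  forall n, mdist (r (nat_Rge0 n)) (r (nat_Rge0 n.+1)) <= S.
Proof.
move=> /(_ 2 (ltr0n _ 2))[S _ rS]; exists S => n; apply/ltW/rS.
by rewrite Rge0_mdistE /= -natrB // subSnn normr1 ltr1n.
Qed.

Lemma proper_tail X (r : Rge0 R -> X) (B : set X) : metrically_proper r ->
  mbounded B -> exists T : R, forall h, T <= val h -> ~ B (r h).
Proof.
move=> rp /rp/Rge0_boundedP[M BM]; exists (M + 1) => h Mh /BM; lra.
Qed.

Lemma proper_nat X (r : Rge0 R -> X) : metrically_proper r ->
  forall B, mbounded B -> exists N, forall n, (N <= n)%N ->
    ~ B (r (nat_Rge0 n)).
Proof.
move=> rp B /(proper_tail rp)[T TB]; have [N TN] := natr_large T.
by exists N => n Nn; apply: TB; rewrite (le_trans TN) // ler_nat.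
Qed.

Lemma ray_joined X (r : Rge0 R -> X) (C : set X) (s t : Rge0 R) :
  continuous r -> val s <= val t ->
  (forall h, val s <= val h <= val t -> C (r h)) ->
  path_component C (r s) (r t).
Proof.
move=> /continuous_mdist rc st rC.
have s0 : 0 <= val s by exact: valP.
have pos x : 0 <= x <= 1 -> 0 <= x * (val t - val s).
  by move=> /andP[x0 _]; rewrite mulr_ge0 // subr_ge0.
have valc x : 0 <= x <= 1 ->
    val (clamp_Rge0 (val s + x * (val t - val s))) = val s + x * (val t - val s).
  by move=> /pos x0; rewrite clamp_Rge0K // addr_ge0.
exists (fun x => r (clamp_Rge0 (val s + x * (val t - val s)))); split.
- apply/within_cont01 => x x01 e e0; have [d d0 dP] := rc (clamp_Rge0 (val s + x * (val t - val s))) e e0.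
  exists (d / (1 + (val t - val s))); first by rewrite divr_gt0 //; lra.
  move=> y y01; rewrite ltr_pdivlMr; last by lra.
  rewrite [X in X < _ -> _]mulrDr mulr1 => xyd; apply: (dP (clamp_Rge0 (val s + y * (val t - val s)))).
  rewrite Rge0_mdistE !valc //.
  rewrite opprD addrACA subrr add0r -mulrBl normrM.
  rewrite [X in _ * X]ger0_norm; last by lra.
  by have := normr_ge0 (x - y); rewrite (distrC y x); lra.
- by rewrite mul0r addr0 val_clamp_Rge0.
- by rewrite mul1r addrC subrK val_clamp_Rge0.
- move=> x; rewrite in_itv /= => x01; apply: rC; rewrite valc //.
  have := pos x x01; rewrite lerDl => -> /=.
  by rewrite -lerBrDl ler_piMl ?subr_ge0 //; case/andP: x01.
Qed.

Lemma ends_equiv_tail X (r r' : ray X) : ends_equiv r r' ->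
  forall B, mbounded B -> exists T : R, forall s s' : Rge0 R,
    T <= val s -> T <= val s' -> path_component (~` B) (r s) (r' s').
Proof.
move=> rr' B /rr'[T [x Bx Tx]]; exists (val T) => s s' Ts Ts'.
have [rs _] := Tx _ Ts; have [_ rs'] := Tx _ Ts'.
exact: path_component_trans (path_component_sym rs) rs'.
Qed.

Lemma ends_equivP X (r r' : ray X) :
  (forall B, mbounded B -> forall T : R, exists s s' : Rge0 R,
    [/\ T <= val s, T <= val s' & path_component (~` B) (r s) (r' s')]) ->
  ends_equiv r r'.
Proof.
move=> freq B Bb.
have [T TB] := proper_tail (@ray_proper _ _ r) Bb.
have [T' TB'] := proper_tail (@ray_proper _ _ r') Bb.
have [T0 TT0] : exists T0 : Rge0 R, Num.max T T' <= val T0.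
  by have [n] := natr_large (Num.max T T'); exists (nat_Rge0 n).
move: TT0; rewrite ge_max => /andP[TT0 T'T0].
have tail h h' : val T0 <= val h -> val T0 <= val h' ->
    path_component (~` B) (r h) (r h') /\ path_component (~` B) (r' h) (r' h').
  wlog hh' : h h' / val h <= val h' => [wl h0 h'0|h0 h'0].
    have [/wl//|h'h] := leP (val h) (val h'); first exact.
    have [] := wl _ _ (ltW h'h) h'0 h0.
    by split; exact: path_component_sym.
  split; apply: ray_joined => //; try exact: ray_continuous.
    by move=> k /andP[hk _] Bk; apply: (TB k) Bk; lra.
  by move=> k /andP[hk _] Bk; apply: (TB' k) Bk; lra.
have [s [s' [Ts Ts' ss']]] := freq B Bb (val T0).
exists T0; exists (r T0); first exact: TB.
move=> h Th; have [rh _] := tail _ _ (lexx _) Th; split=> //.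
have [r0s _] := tail _ _ (lexx _) Ts.
have [_ s'h] := tail _ _ Ts' Th.
exact: path_component_trans r0s (path_component_trans ss' s'h).
Qed.

Lemma ends_equiv_refl X (r : ray X) : ends_equiv r r.
Proof.
apply: ends_equivP => B Bb T; have [T' TB] := proper_tail (@ray_proper _ _ r) Bb.
have [n] := natr_large (Num.max T T'); rewrite ge_max => /andP[Tn T'n].
by exists (nat_Rge0 n), (nat_Rge0 n); split=> //; exact/path_component_refl/TB.
Qed.

Lemma ends_equiv_sym X (r r' : ray X) : ends_equiv r r' -> ends_equiv r' r.
Proof.
move=> rr' B /rr'[T [x Bx Tx]]; exists T; exists x => // s /Tx[]; by split.
Qed.

Lemma ends_equiv_trans X (r r' r'' : ray X) :
  ends_equiv r r' -> ends_equiv r' r'' -> ends_equiv r r''.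
Proof.
move=> /ends_equiv_tail rr' /ends_equiv_tail r'r''; apply: ends_equivP => B Bb T.
have [T1 T1P] := rr' B Bb; have [T2 T2P] := r'r'' B Bb.
have [n] := natr_large (Num.max T (Num.max T1 T2)).
rewrite !ge_max => /and3P[Tn T1n T2n].
exists (nat_Rge0 n), (nat_Rge0 n); split=> //.
exact: path_component_trans (T1P (nat_Rge0 n) (nat_Rge0 n) T1n T1n)
  (T2P (nat_Rge0 n) (nat_Rge0 n) T2n T2n).
Qed.

Lemma ends_equiv_nat X (r r' : ray X) :
  (forall n, r (nat_Rge0 n) = r' (nat_Rge0 n)) -> ends_equiv r r'.
Proof.
move=> rr'; apply: ends_equivP => B Bb T.
have [T' TB] := proper_tail (@ray_proper _ _ r) Bb.
have [n] := natr_large (Num.max T T'); rewrite ge_max => /andP[Tn T'n].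
exists (nat_Rge0 n), (nat_Rge0 n); split=> //; rewrite -rr'.
exact/path_component_refl/TB.
Qed.

End RaysOfRge0.

Section CoarseRepresentative.
Variables (R : realType) (X : metricType R).

Lemma geodesic_choice_exists : geodesic_space X ->
  exists u : X -> X -> R -> X, geodesic_choice u.
Proof.
move=> gX; exists (fun x x' => sval (cid (gX x x'))) => x x'; exact: svalP.
Qed.

(* Sampling times which make the ray r coarse. *)
Lemma fine_sequence (r : Rge0 R -> X) : continuous r -> exists t : nat -> Rge0 R,
  [/\ forall n, val (t n) <= val (t n.+1),
      forall M : R, exists n, M < val (t n) &
      forall n h, val (t n) <= val h <= val (t n.+1) ->
        mdist (r (t n)) (r h) <= 1].
Proof.
move=> /continuous_mdist rc.
pose good (t : Rge0 R) (d : R) := [/\ 0 < d, d <= 1 &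
  forall h, val t <= val h <= val t + d -> mdist (r t) (r h) <= 1].
have step t : exists2 d : R, good t d & forall d', good t d' -> d' <= 2 * d.
  have [d0 d00 d0P] := rc t 1 ltr01.
  have gd0 : good t (Num.min 1 (d0 / 2)).
    split; first by rewrite lt_min ltr01; lra.
      by rewrite ge_min lexx.
    move=> h /andP[th htd]; apply/ltW/d0P; rewrite Rge0_mdistE ger0_norm; last lra.
    have : Num.min 1 (d0 / 2) <= d0 / 2 by rewrite ge_min lexx orbT.
    by lra.
  have sA : has_sup [set d | good t d].
    by split; [exists (Num.min 1 (d0 / 2))|exists 1 => d []].
  have supP d : good t d -> d <= sup [set d | good t d].
    by move=> gd; apply: ub_le_sup => //; case: sA.
  have s0 : 0 < sup [set d | good t d].
    by apply: lt_le_trans (supP _ gd0); case: gd0.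
  have s20 : 0 < sup [set d | good t d] / 2 by lra.
  have [d gd dP] := sup_adherent s20 sA; exists d => // d' /supP; lra.
pose del t := s2val (cid2 (step t)).
have gdel t : good t (del t) by exact: s2valP.
have maxdel t d' : good t d' -> d' <= 2 * del t.
  by move: d'; exact: (s2valP' (cid2 (step t))).
pose next (t : Rge0 R) : Rge0 R := clamp_Rge0 (val t + del t).
have nextE t : val (next t) = val t + del t.
  rewrite clamp_Rge0K // addr_ge0 ?(valP t) //.
  by have [/ltW] := gdel t.
pose t n := iter n next (nat_Rge0 R 0).
have tS n : val (t n.+1) = val (t n) + del (t n) by rewrite /= nextE.
have incr n : val (t n) <= val (t n.+1).
  by rewrite tS lerDl; have [/ltW] := gdel (t n).
exists t; split=> //; last first.
  by move=> n h; rewrite tS; have [_ _] := gdel (t n); apply.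
move=> M; apply: contrapT => /forallNP tM.
pose A := range (fun n => val (t n) : R).
have sA : has_sup A.
  split; first by exists (val (t 0%N)), 0%N.
  by exists M => _ [n _ <-]; rewrite leNgt; exact/negP/tM.
have supP n : val (t n) <= sup A.
  by apply: ub_le_sup; [case: sA|exists n].
have T0 : 0 <= sup A by apply: le_trans (supP 0%N); exact: (valP (t 0%N)).
pose T := clamp_Rge0 (sup A); have TE : val T = sup A by rewrite clamp_Rge0K.
have half_gt0 : 0 < 2^-1 :> R by rewrite invr_gt0.
have [e e0 eP] := rc T (2^-1) half_gt0.
pose e' := Num.min 1 e.
have e'0 : 0 < e' by rewrite lt_min ltr01.
have e'1 : e' <= 1 by rewrite ge_min lexx.
have e'e : e' <= e by rewrite ge_min lexx orbT.
have e'40 : 0 < e' / 4 by lra.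
have [_ [n _ <-] ntT] := sup_adherent e'40 sA.
have tT := supP n.
suff : good (t n) (e' / 2).
  by move=> /maxdel; have := supP n.+1; rewrite tS; lra.
split; [lra|lra|move=> h /andP[th hte]].
have h1 : mdist (r T) (r h) < 2^-1.
  by apply: eP; rewrite Rge0_mdistE TE ltr_norml; apply/andP; split; lra.
have h2 : mdist (r T) (r (t n)) < 2^-1.
  by apply: eP; rewrite Rge0_mdistE TE ltr_norml; apply/andP; split; lra.
have := metric_triangle (r (t n)) (r T) (r h).
by rewrite (metric_sym (r (t n)) (r T)); lra.
Qed.

Lemma coarse_representative (r : ray X) : geodesic_space X ->
  exists2 r' : ray X, controlled r' & ends_equiv r' r.
Proof.
move=> gX; have [u ug] := geodesic_choice_exists gX.
have rc := @ray_continuous _ _ r; have rp := @ray_proper _ _ r.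
have [t [tS tM tP]] := fine_sequence rc.
have tmono m n : (m <= n)%N -> val (t m) <= val (t n).
  move=> /subnKC <-; elim: (n - m)%N => [|k IH]; first by rewrite addn0.
  by rewrite addnS (le_trans IH).
pose a (h : Rge0 R) := r (t (Num.trunc (val h))).
have aE n : a (nat_Rge0 R n) = r (t n) by rewrite /a /= natrK.
have aS n : mdist (a (nat_Rge0 R n)) (a (nat_Rge0 R n.+1)) <= 1.
  by rewrite !aE; apply: tP; rewrite tS lexx.
have ap B : mbounded B -> exists N, forall n, (N <= n)%N -> ~ B (a (nat_Rge0 R n)).
  move=> /(proper_tail rp)[T TB]; have [N TN] := tM T.
  exists N => n Nn; rewrite aE; apply: TB.
  by apply: le_trans (ltW TN) _; exact: tmono.
exists (Ray (star_continuous (r := a) ug) (star_proper ug aS ap)).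
  exact: star_controlled ug aS.
apply: ends_equivP => B Bb T; have [N NB] := ap B Bb.
have [N' TN'] := natr_large T; have [N'' TN''] := tM T.
pose n := maxn N (maxn N' N''); exists (nat_Rge0 R n), (t n).
split.
- by apply: le_trans TN' _; rewrite ler_nat /n !leq_max leqnn orbT.
- by apply: le_trans (ltW TN'') _; apply: tmono; rewrite /n !leq_max leqnn !orbT.
- rewrite /= star_nat // aE; apply: path_component_refl; rewrite -aE.
  by apply: NB; rewrite /n leq_maxl.
Qed.

End CoarseRepresentative.

Section EndsObject.
Variables (R : realType) (X : metricType R).

Definition ends_rel : rel (ray X) := fun r r' => `[< ends_equiv r r' >].

Lemma ends_rel_refl : reflexive ends_rel.
Proof. by move=> r; apply/asboolP; exact: ends_equiv_refl. Qed.

Lemma ends_rel_sym : symmetric ends_rel.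
Proof. by move=> r r'; apply/asbool_equiv_eq; split; exact: ends_equiv_sym. Qed.

Lemma ends_rel_trans : transitive ends_rel.
Proof.
move=> r' r r'' /asboolP rr' /asboolP r'r''; apply/asboolP.
exact: ends_equiv_trans rr' r'r''.
Qed.

Canonical ends_equiv_rel :=
  EquivRel ends_rel ends_rel_refl ends_rel_sym ends_rel_trans.

Definition Ends := {eq_quot ends_equiv_rel}.

Definition end_of (r : ray X) : Ends := \pi_Ends r.

Lemma end_of_eq (r r' : ray X) : end_of r = end_of r' <-> ends_equiv r r'.
Proof. by split=> [/eqmodP/asboolP//|rr']; apply/eqmodP/asboolP. Qed.

Lemma end_of_surj (e : Ends) : exists r, end_of r = e.
Proof. by exists (repr e); exact: reprK. Qed.

End EndsObject.

Section EndsMap.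
Variable R : realType.
Implicit Types X Y Z : pgeo R.

Lemma ends_coarse_representative X (e : Ends X) :
  exists2 r : ray X, controlled r & end_of r = e.
Proof.
have [r <-] := end_of_surj e.
have [r' r'c r'r] := coarse_representative r (@pgeo_geodesic _ X).
by exists r' => //; apply/end_of_eq.
Qed.

Lemma star_comp_proper X Y (u : Y -> Y -> R -> Y) (f : coarse_map X Y)
    (r : ray X) :
  geodesic_choice u -> controlled r -> metrically_proper (star u (f \o r)).
Proof.
move=> ug rc.
have [S fS] := controlled_nat (controlled_comp (coarse_controlled f) rc).
apply: (star_proper ug fS); apply: proper_nat.
exact: proper_comp (@coarse_proper _ _ _ f) (@ray_proper _ _ r).
Qed.

Definition geodesics Y : Y -> Y -> R -> Y :=
  sval (cid (geodesic_choice_exists (@pgeo_geodesic _ Y))).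

Lemma geodesicsP Y : geodesic_choice (@geodesics Y).
Proof. exact: svalP. Qed.

Definition coarse_ray X (e : Ends X) : ray X :=
  s2val (cid2 (ends_coarse_representative e)).

Lemma coarse_ray_controlled X (e : Ends X) : controlled (coarse_ray e).
Proof. exact: (s2valP (cid2 (ends_coarse_representative e))). Qed.

Lemma coarse_rayK X (e : Ends X) : end_of (coarse_ray e) = e.
Proof. exact: (s2valP' (cid2 (ends_coarse_representative e))). Qed.

(* The map end(r) |-> end((f o r)^* ), computed on a coarse representative r:
   for a ray r that is merely continuous and proper, geodesics between
   f (r n) and f (r n.+1) may return to a bounded set infinitely often, so that
   (f o r)^* need not be proper (take r in the plane with r n = ((-1)^n n, 0),
   joining these points by half circles, and f = id). By ends_mapE the formula
   holds for all rays r and all choices of geodesics for which (f o r)^* is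
   proper, and by star_comp_proper this is the case when r is coarse. *)
Definition ends_map X Y (f : coarse_map X Y) (e : Ends X) : Ends Y :=
  end_of (Ray (star_continuous (r := f \o coarse_ray e) (@geodesicsP Y))
    (star_comp_proper f (@geodesicsP Y) (@coarse_ray_controlled X e))).

Lemma ends_mapE X Y (f : coarse_map X Y) (r : ray X) (u : Y -> Y -> R -> Y)
    (ug : geodesic_choice u) (fr : metrically_proper (star u (f \o r))) :
  ends_map f (end_of r) = end_of (Ray (star_continuous (r := f \o r) ug) fr).
Proof.
apply/end_of_eq; set r0 := coarse_ray _.
have /end_of_eq/ends_equiv_tail r0r : end_of r0 = end_of r by exact: coarse_rayK.
apply: ends_equivP => B Bb T.
have [S _ fS] := coarse_controlled f ltr01.
have [T' T'P] := r0r _ (coarse_proper f (mbounded_nbhd S Bb)).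
have [n] := natr_large (Num.max T T'); rewrite ge_max => /andP[Tn T'n].
exists (nat_Rge0 R n), (nat_Rge0 R n); split=> //=.
rewrite !star_nat //; last exact: geodesicsP.
apply: joined_image (@pgeo_geodesic _ Y) fS _.
exact: (T'P (nat_Rge0 R n) (nat_Rge0 R n)).
Qed.

Lemma ends_map_id X (e : Ends X) : ends_map (coarse_id X) e = e.
Proof.
rewrite -[RHS]coarse_rayK; apply/end_of_eq/ends_equiv_nat => n /=.
by rewrite star_nat //; exact: geodesicsP.
Qed.

Lemma ends_map_comp X Y Z (g : coarse_map Y Z) (f : coarse_map X Y) (e : Ends X) :
  ends_map (coarse_comp g f) e = ends_map g (ends_map f e).
Proof.
rewrite [ends_map f e]/ends_map; set s := Ray _ _.
have sc : controlled s.
  have [S fS] := controlled_nat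
    (controlled_comp (coarse_controlled f) (@coarse_ray_controlled X e)).
  exact: star_controlled (@geodesicsP Y) fS.
rewrite (ends_mapE (@geodesicsP Z) (star_comp_proper g (@geodesicsP Z) sc)).
apply/end_of_eq/ends_equiv_nat => n /=.
by rewrite !star_nat //=; [rewrite star_nat //; exact: geodesicsP|exact: geodesicsP..].
Qed.

End EndsMap.

Section Cylinder.
Variables (R : realType) (X : metricType R) (q : X -> Rge0 R).

(* The space I_q X. *)
Definition cylinder :=
  @sub_metric R (X * Rge0 R)%type (fun p => val p.2 <= val (q p.1)).

HB.instance Definition _ := Metric.on cylinder.

Definition cylinder_bottom (x : X) : cylinder :=
  Sub (x, Sub (0 : R^o) (lexx 0)) (valP (q x)).

Definition cylinder_top (x : X) : cylinder := Sub (x, q x) (lexx _).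

End Cylinder.

Section CoarseHomotopy.
Variable R : realType.
Implicit Types X Y Z : metricType R.

Definition coarse_homotopic X Y (f g : coarse_map X Y) :=
  exists (q : coarse_map X (Rge0 R)) (H : coarse_map (cylinder q) Y),
    (forall x, H (cylinder_bottom q x) = f x) /\
    (forall x, H (cylinder_top q x) = g x).

Lemma cylinder_mdistE X (q : X -> Rge0 R) (p p' : cylinder q) :
  mdist p p' = Num.max (mdist (val p).1 (val p').1)
                 `|val (val p').2 - val (val p).2|.
Proof.
rewrite -Rge0_mdistE; exact: (prod_mdistE (val p) (val p')).
Qed.

Lemma cylinder_boundedP X (q : X -> Rge0 R) (A : set (cylinder q)) (x0 : X) :
  mbounded A <-> exists M : R, forall p, A p ->
    mdist x0 (val p).1 <= M /\ val (val p).2 <= M.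
Proof.
have dE p : mdist (cylinder_bottom q x0) p =
    Num.max (mdist x0 (val p).1) (val (val p).2).
  by rewrite cylinder_mdistE /= subr0 ger0_norm // (valP (val p).2).
split=> [/(mboundedP _ (cylinder_bottom q x0))[M AM]|[M AM]].
  by exists M => p /AM; rewrite dE ge_max => /andP[].
apply/(mboundedP _ (cylinder_bottom q x0)); exists M => p /AM[px pt].
by rewrite dE ge_max px pt.
Qed.

Lemma min_dist (t t' a a' r s : R) : `|t' - t| < r -> `|a' - a| < s ->
  `|Num.min t' a' - Num.min t a| < r + s.
Proof.
have := normr_ge0 (t' - t); have := normr_ge0 (a' - a) => a0 t0 tr as_.
have s0 : 0 < s by lra.
have r0 : 0 < r by lra.
move: tr as_; rewrite !ltr_norml => /andP[t1 t2] /andP[a1 a2].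
by case: (leP t' a') => ?; case: (leP t a) => ?; apply/andP; split; lra.
Qed.

Lemma max_dist (t t' a a' r s : R) : `|t' - t| < r -> `|a' - a| < s ->
  `|Num.max 0 (t' - a') - Num.max 0 (t - a)| < r + s.
Proof.
have := normr_ge0 (t' - t); have := normr_ge0 (a' - a) => a0 t0 tr as_.
have s0 : 0 < s by lra.
have r0 : 0 < r by lra.
move: tr as_; rewrite !ltr_norml => /andP[t1 t2] /andP[a1 a2].
by case: (leP 0 (t' - a')) => ?; case: (leP 0 (t - a)) => ?;
  apply/andP; split; lra.
Qed.

Lemma coarse_homotopic_refl X (f : coarse_map (Rge0 R) X) :
  coarse_homotopic f f.
Proof.
pose q := coarse_id (Rge0 R); pose H (p : cylinder q) := f (val p).1.
have Hc : controlled H.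
  move=> r /(coarse_controlled f)[s s0 fs]; exists s => // p p'.
  by rewrite cylinder_mdistE gt_max => /andP[/fs].
have Hp : metrically_proper H.
  move=> B /(coarse_proper f)/Rge0_boundedP[M BM].
  apply/(cylinder_boundedP _ (nat_Rge0 R 0)); exists M => p /BM pM.
  rewrite Rge0_mdistE /= subr0 ger0_norm ?(valP (val p).1) //.
  by split=> //; exact: le_trans (valP p) pM.
by exists q, (CoarseMap Hc Hp); split.
Qed.

Lemma coarse_homotopic_sym X Y (f g : coarse_map X Y) :
  coarse_homotopic f g -> coarse_homotopic g f.
Proof.
move=> [q [H [H0 H1]]].
have flip_ge0 (p : cylinder q) : 0 <= val (q (val p).1) - val (val p).2.
  by rewrite subr_ge0; exact: valP p.
have flip_le (p : cylinder q) :
    val (q (val p).1) - val (val p).2 <= val (q (val p).1).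
  by rewrite gerBl; exact: valP (val p).2.
pose flip (p : cylinder q) : cylinder q :=
  Sub ((val p).1, Sub (_ : R^o) (flip_ge0 p)) (flip_le p).
have flipK : involutive flip.
  move=> p; apply: val_inj; rewrite [RHS]surjective_pairing /=.
  by congr pair; apply: val_inj; rewrite /= subKr.
have flipc : controlled flip.
  move=> r r0; have [s s0 qs] := coarse_controlled q r0.
  exists (s + r); first exact: addr_gt0.
  move=> p p'; rewrite !cylinder_mdistE !gt_max /= => /andP[xr tr].
  apply/andP; split; first by apply: lt_trans xr _; rewrite ltrDr.
  have := qs _ _ xr; rewrite Rge0_mdistE => qr.
  rewrite opprB addrACA -opprB opprK addrC.
  rewrite (_ : _ + _ = (val (q (val p').1) - val (q (val p).1)) -
    (val (val p').2 - val (val p).2)); last by rewrite /=; lra.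
  by apply: le_lt_trans (ler_normB _ _) _; exact: ltrD.
have flipp : metrically_proper flip.
  move=> B [M BM]; have M0 : 0 < Num.max M 0 + 1.
    by rewrite ltr_wpDl // le_max lexx orbT.
  have [s s0 fs] := flipc _ M0; exists s => p p' Bp Bp'.
  rewrite -(flipK p) -(flipK p'); apply/ltW/fs.
  apply: le_lt_trans (BM _ _ Bp Bp') _.
  by apply: (@le_lt_trans _ _ (Num.max M 0)); rewrite ?ltrDl // le_max lexx.
exists q, (coarse_comp H (CoarseMap flipc flipp)); split=> x /=.
  rewrite -H1; congr (H _); apply: val_inj => /=; congr pair.
  by apply: val_inj; rewrite /= subr0.
rewrite -H0; congr (H _); apply: val_inj => /=; congr pair.
by apply: val_inj; rewrite /= subrr.
Qed.

Lemma coarse_homotopic_trans X Y (f g h : coarse_map X Y) (x0 : X) :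
  coarse_homotopic f g -> coarse_homotopic g h -> coarse_homotopic f h.
Proof.
move=> [q1 [H1 [H10 H11]]] [q2 [H2 [H20 H21]]].
have q_ge0 x : 0 <= val (q1 x) + val (q2 x).
  by rewrite addr_ge0; [|exact: valP (q1 x)|exact: valP (q2 x)].
pose qf x : Rge0 R := Sub (_ : R^o) (q_ge0 x).
have qc : controlled qf.
  move=> r r0; have [s1 s10 qs1] := coarse_controlled q1 r0.
  have [s2 s20 qs2] := coarse_controlled q2 r0.
  exists (s1 + s2); first exact: addr_gt0.
  move=> x x' xr; rewrite Rge0_mdistE /= opprD addrACA.
  apply: le_lt_trans (ler_normD _ _) _; apply: ltrD; first exact: qs1.
  exact: qs2.
have qp : metrically_proper qf.
  move=> B /Rge0_boundedP[M BM].
  have : mbounded [set t : Rge0 R | val t <= M] by apply/Rge0_boundedP; exists M.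
  move=> /(coarse_proper q1); apply: mboundedS => x /BM /=.
  by apply: le_trans; rewrite lerDl; exact: valP (q2 x).
pose q := CoarseMap qc qp.
have lo_ge0 (p : cylinder q) : 0 <= Num.min (val (val p).2) (val (q1 (val p).1)).
  by rewrite le_min; apply/andP; split; [exact: valP (val p).2|exact: valP (q1 _)].
have lo_le (p : cylinder q) :
    Num.min (val (val p).2) (val (q1 (val p).1)) <= val (q1 (val p).1).
  by rewrite ge_min lexx orbT.
pose lo (p : cylinder q) : cylinder q1 :=
  Sub ((val p).1, Sub (_ : R^o) (lo_ge0 p)) (lo_le p).
have hi_ge0 (p : cylinder q) : 0 <= Num.max 0 (val (val p).2 - val (q1 (val p).1)).
  by rewrite le_max lexx.
have hi_le (p : cylinder q) :
    Num.max 0 (val (val p).2 - val (q1 (val p).1)) <= val (q2 (val p).1).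
  rewrite ge_max; apply/andP; split; first exact: valP (q2 _).
  by rewrite lerBlDl; exact: valP p.
pose hi (p : cylinder q) : cylinder q2 :=
  Sub ((val p).1, Sub (_ : R^o) (hi_ge0 p)) (hi_le p).
have lohi_c (r : R) : 0 < r -> exists2 s : R, 0 < s &
    forall p p' : cylinder q, mdist p p' < r ->
    mdist (lo p) (lo p') < s /\ mdist (hi p) (hi p') < s.
  move=> r0; have [s s0 qs] := coarse_controlled q1 r0.
  exists (r + s); first exact: addr_gt0.
  move=> p p'; rewrite !cylinder_mdistE !gt_max /= => /andP[xr tr].
  have {}qs := qs _ _ xr; rewrite Rge0_mdistE in qs.
  have xrs : mdist (val p).1 (val p').1 < r + s by rewrite (lt_trans xr) ?ltrDl.
  by split; rewrite xrs /=; [exact: min_dist|exact: max_dist].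
pose H (p : cylinder q) :=
  if val (val p).2 <= val (q1 (val p).1) then H1 (lo p) else H2 (hi p).
have H_lo p : val (q1 (val p).1) <= val (val p).2 -> H1 (lo p) = g (val p).1.
  move=> qt; rewrite -H11; congr (H1 _); apply: val_inj => /=; congr pair.
  by apply: val_inj; rewrite /= min_r.
have H_hi p : val (val p).2 <= val (q1 (val p).1) -> H2 (hi p) = g (val p).1.
  move=> tq; rewrite -H20; congr (H2 _); apply: val_inj => /=; congr pair.
  by apply: val_inj; rewrite /= max_l // subr_le0.
have Hc : controlled H.
  move=> r r0; have [s s0 lohi] := lohi_c r r0.
  have [s1 s10 H1s] := coarse_controlled H1 s0.
  have [s2 s20 H2s] := coarse_controlled H2 s0.
  have [s3 s30 gs] := coarse_controlled g r0.
  exists (s1 + s2 + s3); first by rewrite !addr_gt0.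
  suff mixed (p p' : cylinder q) : mdist p p' < r -> val (val p).2 <= val (q1 (val p).1) ->
      val (q1 (val p').1) < val (val p').2 ->
      mdist (H1 (lo p)) (H2 (hi p')) < s1 + s2 + s3.
    move=> p p' pp'; have [/H1s l1 /H2s h2] := lohi _ _ pp'.
    rewrite /H; case: (leP (val (val p).2)) => tq;
      case: (leP (val (val p').2)) => tq'.
    - by apply: lt_trans l1 _; rewrite -addrA ltrDl addr_gt0.
    - exact: mixed.
    - by rewrite metric_sym; apply: mixed; rewrite // metric_sym.
    - by apply: lt_trans h2 _; rewrite addrAC ltrDr addr_gt0.
  move=> pp' tq tq'; have [/H1s l1 /H2s h2] := lohi _ _ pp'.
  rewrite (H_lo p' (ltW tq')) in l1; rewrite (H_hi p tq) in h2.
  have xx' : mdist (g (val p).1) (g (val p').1) < s3.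
    by apply: gs; move: pp'; rewrite cylinder_mdistE gt_max => /andP[].
  apply: le_lt_trans (metric_triangle _ (g (val p').1) _) _.
  rewrite -addrA; apply: ltrD l1 _; rewrite addrC.
  apply: le_lt_trans (metric_triangle _ (g (val p).1) _) _.
  by rewrite (metric_sym (g (val p').1)); apply: ltrD xx' h2.
have Hp : metrically_proper H.
  move=> B Bb; apply/(cylinder_boundedP _ x0).
  have /(cylinder_boundedP _ x0)[M1 BM1] := coarse_proper H1 Bb.
  have /(cylinder_boundedP _ x0)[M2 BM2] := coarse_proper H2 Bb.
  have M0 : 0 < Num.max M2 0 + 1 by rewrite ltr_wpDl // le_max lexx orbT.
  have [s s0 qs] := coarse_controlled q1 M0.
  pose N := Num.max M1 (M2 + (val (q1 x0) + s)).
  have NM1 : M1 <= N by rewrite le_max lexx.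
  have NM2 : M2 + (val (q1 x0) + s) <= N by rewrite le_max lexx orbT.
  have q10 : 0 <= val (q1 x0) by exact: valP.
  exists N => p; rewrite /preimage /= /H; case: leP => tq.
    move=> /BM1 /=; rewrite min_l // => -[xM tM].
    by split; apply: le_trans NM1.
  move=> /BM2 /=; rewrite ge_max => -[xM /andP[_ tM]].
  have : mdist x0 (val p).1 < Num.max M2 0 + 1.
    apply: (@le_lt_trans _ _ (Num.max M2 0)); last by rewrite ltrDl.
    by rewrite le_max xM.
  move=> /qs; rewrite Rge0_mdistE ltr_norml => /andP[_ q1s].
  split; first by apply: le_trans xM _; apply: le_trans NM2; rewrite lerDl addr_ge0 // ltW.
  move: tM; rewrite lerBlDr => tM; apply: le_trans tM _; apply: le_trans NM2.
  by rewrite lerD2l; apply/ltW; rewrite -ltrBlDl.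
exists q, (CoarseMap Hc Hp); split=> x /=.
  rewrite /H /= ifT; last exact: valP (q1 x).
  rewrite -H10; congr (H1 _); apply: val_inj => /=; congr pair.
  by apply: val_inj; rewrite /= min_l //; exact: valP (q1 x).
rewrite /H /= -H21; case: leP => [qle|_].
  have q20 : val (q2 x) = 0.
    have := valP (q2 x); move: qle => /=; rewrite gerDl => q2l q2g.
    by apply/eqP; rewrite eq_le q2l.
  rewrite -[LHS]/(H1 (lo (cylinder_top q x))) H_lo; last by rewrite /= lerDl; exact: valP (q2 x).
  rewrite -H20; congr (H2 _); apply: val_inj => /=; congr pair.
  exact: val_inj.
congr (H2 _); apply: val_inj => /=; congr pair.
by apply: val_inj; rewrite /= addrC addKr max_r //; exact: valP (q2 x).
Qed.

Lemma coarse_homotopic_comp X Y Z (h : coarse_map Y Z) (f g : coarse_map X Y) :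
  coarse_homotopic f g ->
  coarse_homotopic (coarse_comp h f) (coarse_comp h g).
Proof.
move=> [q [H [H0 H1]]]; exists q, (coarse_comp h H).
by split=> x /=; rewrite ?H0 ?H1.
Qed.

End CoarseHomotopy.

Section Pi0Object.
Variables (R : realType) (X : metricType R).

Definition pi0_rel : rel (coarse_map (Rge0 R) X) :=
  fun a b => `[< coarse_homotopic a b >].

Lemma pi0_rel_refl : reflexive pi0_rel.
Proof. by move=> a; apply/asboolP; exact: coarse_homotopic_refl. Qed.

Lemma pi0_rel_sym : symmetric pi0_rel.
Proof.
by move=> a b; apply/asbool_equiv_eq; split; exact: coarse_homotopic_sym.
Qed.

Lemma pi0_rel_trans : transitive pi0_rel.
Proof.
move=> b a c /asboolP ab /asboolP bc; apply/asboolP.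
exact: coarse_homotopic_trans (nat_Rge0 R 0) ab bc.
Qed.

Canonical pi0_equiv_rel :=
  EquivRel pi0_rel pi0_rel_refl pi0_rel_sym pi0_rel_trans.

Definition Pi0 := {eq_quot pi0_equiv_rel}.

Definition pi0_class (a : coarse_map (Rge0 R) X) : Pi0 := \pi_Pi0 a.

Lemma pi0_class_eq (a b : coarse_map (Rge0 R) X) :
  pi0_class a = pi0_class b <-> coarse_homotopic a b.
Proof. by split=> [/eqmodP/asboolP//|ab]; apply/eqmodP/asboolP. Qed.

Lemma pi0_class_surj (c : Pi0) : exists a, pi0_class a = c.
Proof. by exists (repr c); exact: reprK. Qed.

End Pi0Object.

Section Pi0Map.
Variable R : realType.
Implicit Types X Y Z : metricType R.

Definition pi0_map X Y (f : coarse_map X Y) (c : Pi0 X) : Pi0 Y :=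
  pi0_class (coarse_comp f (repr c)).

Lemma pi0_mapE X Y (f : coarse_map X Y) (a : coarse_map (Rge0 R) X) :
  pi0_map f (pi0_class a) = pi0_class (coarse_comp f a).
Proof. by apply/pi0_class_eq/coarse_homotopic_comp/pi0_class_eq; exact: reprK. Qed.

Lemma pi0_map_id X (c : Pi0 X) : pi0_map (coarse_id X) c = c.
Proof.
have [a <-] := pi0_class_surj c; rewrite pi0_mapE; congr pi0_class.
exact: coarse_map_eq.
Qed.

Lemma pi0_map_comp X Y Z (g : coarse_map Y Z) (f : coarse_map X Y) (c : Pi0 X) :
  pi0_map (coarse_comp g f) c = pi0_map g (pi0_map f c).
Proof.
have [a <-] := pi0_class_surj c; rewrite !pi0_mapE; congr pi0_class.
exact: coarse_map_eq.
Qed.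

End Pi0Map.

Section Functors.
Variable R : realType.

(* Functors from proper geodesic metric spaces and coarse maps to sets. *)
Record set_functor := SetFunctor {
  fobj :> pgeo R -> Type;
  fmap : forall X Y : pgeo R, coarse_map X Y -> fobj X -> fobj Y;
  fmap_id : forall (X : pgeo R) (a : fobj X), fmap (coarse_id X) a = a;
  fmap_comp : forall (X Y Z : pgeo R) (g : coarse_map Y Z) (f : coarse_map X Y)
    (a : fobj X), fmap (coarse_comp g f) a = fmap g (fmap f a) }.

Record nat_trans (F G : set_functor) := NatTrans {
  component :> forall X : pgeo R, F X -> G X;
  naturality : forall (X Y : pgeo R) (f : coarse_map X Y) (a : F X),
    component (fmap f a) = fmap f (component a) }.

Definition pi0_functor : set_functor :=
  @SetFunctor (fun X : pgeo R => Pi0 X) (fun X Y f => pi0_map f)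
    (fun X => @pi0_map_id R X) (fun X Y Z => @pi0_map_comp R X Y Z).

Definition ends_functor : set_functor :=
  @SetFunctor (fun X : pgeo R => Ends X) (fun X Y f => ends_map f)
    (fun X => @ends_map_id R X) (fun X Y Z => @ends_map_comp R X Y Z).

End Functors.

(* Main.v *)
(** A coarse map from the half line, interpolated by geodesics between its
    values at the integers, is a proper ray; this defines the transformation on
    representatives. A coarse homotopy H of coarse rays, restricted to the fibre
    {n} x [0, q n] for n large, is a chain of steps of bounded length which
    avoids a prescribed bounded set, so homotopic coarse rays define the same
    end. Surjectivity holds because every end is represented by a ray that is
    itself a coarse map. *)
Require Import Defs.
From mathcomp Require Import all_boot all_order all_algebra.
From mathcomp Require Import all_classical all_reals topology normedtype.
From mathcomp Require Import lra.

Import Order.TTheory GRing.Theory Num.Theory.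

Local Open Scope classical_set_scope.
Local Open Scope ring_scope.

(** A geodesic of length at most [e] starting outside [nbhd B e] cannot meet [B]; induction
    concatenates such geodesics. *)
Lemma chain_joined (R : realType) (X : metricType R) (B : set X) (e : R)
    (x : nat -> X) (n : nat) :
  geodesic_space X -> (forall k, ~ nbhd B e (x k)) ->
  (forall k, mdist (x k) (x k.+1) <= e) -> path_component (~` B) (x 0%N) (x n).
Proof.
move=> gX xB xe; elim: n => [|n IH].
  apply: path_component_refl => Bx; apply: (xB 0%N).
  exists (x 0%N) => //; rewrite mdistxx.
  exact: le_trans (mdist_ge0 _ _) (xe 0%N).
exact: path_component_trans IH (joined_close gX (xB n) (xe n)).
Qed.

Section EndOfCoarseMap.
Variables (R : realType) (X : pgeo R).
Implicit Types a b : coarse_map (Rge0 R) X.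

Lemma star_coarse_controlled a : controlled (star (@geodesics R X) a).
Proof.
have [S aS] := controlled_nat (coarse_controlled a).
exact: star_controlled (@geodesicsP R X) aS.
Qed.

Lemma star_coarse_proper a : metrically_proper (star (@geodesics R X) a).
Proof.
have [S aS] := controlled_nat (coarse_controlled a).
apply: (star_proper (@geodesicsP R X) aS).
exact: (proper_nat (@coarse_proper _ _ _ a)).
Qed.

Definition star_ray a : ray X :=
  Ray (star_continuous (r := a) (@geodesicsP R X)) (star_coarse_proper a).

Lemma star_ray_nat a n : star_ray a (nat_Rge0 R n) = a (nat_Rge0 R n).
Proof. exact/star_nat/geodesicsP. Qed.

Lemma coarse_homotopic_ends_equiv a b :
  coarse_homotopic a b -> ends_equiv (star_ray a) (star_ray b).
Proof.
move=> [q [H [H0 H1]]]; apply: ends_equivP => B Bb T.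
(* Consecutive points of the chain [p] below are at distance at most 1, so the strict bound 2 covers
   them. *)
have [S _ HS] := @coarse_controlled _ _ _ H 2 (ltr0n _ 2).
have /(cylinder_boundedP _ (nat_Rge0 R 0))[M BM] :=
  @coarse_proper _ _ _ H _ (mbounded_nbhd S Bb).
(* As [n > M], the map [H] sends no point of the fibre over [n] into [nbhd B S]. *)
have [n] := natr_large (Num.max T (M + 1)); rewrite ge_max => /andP[Tn Mn].
exists (nat_Rge0 R n), (nat_Rge0 R n); split; rewrite // !star_ray_nat.
have [N qN] := natr_large (val (q (nat_Rge0 R n))).
have q0 : 0 <= val (q (nat_Rge0 R n)) by exact: valP.
(* Truncation at [q n] keeps every height in the fibre and makes [p N] its top point. *)
pose h k := Num.min k%:R (val (q (nat_Rge0 R n))).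
have h0 k : 0 <= h k by rewrite /h le_min ler0n q0.
have hq k : h k <= val (q (nat_Rge0 R n)) by rewrite /h ge_min lexx orbT.
pose p k : cylinder q := Sub (nat_Rge0 R n, Sub (_ : R^o) (h0 k)) (hq k).
have -> : a (nat_Rge0 R n) = H (p 0%N).
  rewrite -H0; congr (H _); apply: val_inj => /=; congr pair.
  by apply: val_inj; rewrite /= /h min_l.
have -> : b (nat_Rge0 R n) = H (p N).
  rewrite -H1; congr (H _); apply: val_inj => /=; congr pair.
  by apply: val_inj; rewrite /= /h min_r.
apply: (@chain_joined _ _ B S (fun k => H (p k)) N (@pgeo_geodesic _ X)) => k.
  move=> /BM[+ _]; rewrite Rge0_mdistE /= subr0 ger0_norm ?ler0n //; lra.
apply/ltW/HS; rewrite cylinder_mdistE /= mdistxx gt_max ltr0n /=.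
rewrite /h -natr1; case: (leP k%:R) => ?; case: (leP (k%:R + 1)) => ?;
  rewrite ltr_norml; apply/andP; split; lra.
Qed.

Definition pi0_end (c : Pi0 X) : Ends X := end_of (star_ray (repr c)).

Lemma pi0_endE a : pi0_end (pi0_class a) = end_of (star_ray a).
Proof.
by apply/end_of_eq/coarse_homotopic_ends_equiv/pi0_class_eq; exact: reprK.
Qed.

(** A controlled representative is a coarse map; interpolation keeps its values at the integers, and
    these determine its end. *)
Lemma pi0_end_surj (e : Ends X) : exists c, pi0_end c = e.
Proof.
have [r rc <-] := ends_coarse_representative e.
exists (pi0_class (CoarseMap rc (@ray_proper _ _ r))); rewrite pi0_endE.
by apply/end_of_eq/ends_equiv_nat => n; rewrite star_ray_nat.
Qed.

End EndOfCoarseMap.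

(** Both sides are ends of rays through the points [f (a n)]: since [star_ray a] is controlled,
    [ends_map f] may be computed on it. *)
Lemma pi0_end_natural (R : realType) (X Y : pgeo R) (f : coarse_map X Y)
    (c : Pi0 X) :
  pi0_end R Y (pi0_map f c) = ends_map f (pi0_end R X c).
Proof.
have [a <-] := pi0_class_surj c; rewrite pi0_mapE !pi0_endE.
have rc : controlled (star_ray R X a) by exact: star_coarse_controlled.
rewrite (ends_mapE (@geodesicsP R Y) (star_comp_proper f (@geodesicsP R Y) rc)).
apply/end_of_eq/ends_equiv_nat => n; rewrite star_ray_nat /=.
by rewrite !star_nat /= ?star_nat //; exact: geodesicsP.
Qed.

Theorem theorem7p4 (R : realType) :
  exists eta : nat_trans (pi0_functor R) (ends_functor R),
    forall (X : pgeo R) (e : ends_functor R X),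
      exists c : pi0_functor R X, eta X c = e.
Proof.
exists (@NatTrans R (pi0_functor R) (ends_functor R) (pi0_end R)
  (pi0_end_natural R)) => X e.
exact: pi0_end_surj.
Qed.
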